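(* Let $H$ be a real Hilbert space, let $G$ be a finite group acting isometrically on $H$, and let $Y_1,\dots,Y_I\in H$ be a sample ($I\ge1$). Let $\hat m\in H$ be the result of the max-max algorithm applied to this sample (from some starting point $m_0\in H$). If for every $i\in\{1,\dots,I\}$ the registration of $Y_i$ with respect to $\hat m$ is unique, i.e. there is a unique $g\in G$ minimizing $g\mapsto\|\hat m-g\cdot Y_i\|$ over $G$, then $\hat m$ is a local minimum of the empirical variance $$F_I(x)=\frac1I\sum_{i=1}^I\min_{g_i\in G}\|x-g_i\cdot Y_i\|^2,\qquad x\in H,$$ that is, $[\hat m]$ is an empirical Karcher mean.
   Context: $H$ is a Hilbert space with inner product $\langle\cdot,\cdot\rangle$ and norm $\|\cdot\|$. The group $G$ (with identity $e$) acts isometrically on $H$: for each $g\in G$ the map $x\mapsto g\cdot x$ is a linear automorphism of $H$ with $\|g\cdot x\|=\|x\|$, and $g'\cdot(g\cdot x)=(g'g)\cdot x$, $e\cdot x=x$ for all $x\in H$, $g,g'\in G$. The orbit of $x$ is $[x]=\{g\cdot x: g\in G\}$. An element of $H$ which locally minimizes $F_I$ (or its orbit) is called an empirical Karcher mean. For $x\in H$ and $\underline g=(g_1,\dots,g_I)\in G^I$ define $$J(x,\underline g)=\frac1I\sum_{i=1}^I\|x-g_i\cdot Y_i\|^2 .$$ Max-max algorithm: given a starting point $m_0\in H$, for $n=0,1,2,\dots$: (1) choose $\underline g^n=(g_1^n,\dots,g_I^n)\in G^I$ minimizing $\underline g\mapsto J(m_n,\underline g)$ over $G^I$, i.e. for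 each $i$, $g_i^n$ minimizes $g\mapsto\|m_n-g\cdot Y_i\|$ over $G$ (registration of $Y_i$ with respect to $m_n$); (2) let $m_{n+1}$ be the minimizer of $x\mapsto J(x,\underline g^n)$ over $H$, i.e. $m_{n+1}=\frac1I\sum_{i=1}^I g_i^n\cdot Y_i$. The algorithm stops at the first $n$ such that $m_{n+1}=m_n$, and its result is $\hat m=m_n$ for this $n$ (so $\hat m=m_n=m_{n+1}=\frac1I\sum_{i=1}^I g_i^n\cdot Y_i$). *)

(* Defs.v *)
From mathcomp Require Import all_boot all_order all_algebra all_fingroup.
From mathcomp Require Import all_classical all_reals all_analysis.

Set Implicit Arguments.
Unset Strict Implicit.
Unset Printing Implicit Defensive.

Import Order.TTheory GRing.Theory Num.Theory.
Import numFieldNormedType.Exports.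

Local Open Scope classical_set_scope.
Local Open Scope ring_scope.

(* [dot] is an inner product inducing the norm of the complete space [H]. *)
Definition hilbert_norm (R : realType) (H : completeNormedModType R)
    (dot : {dot H for idfun}) : Prop :=
  forall x : H, `|x| = Num.sqrt (dot x x).

(* A left action, whereas the actions of the fingroup library are right
   actions. *)
Record isometric_action (R : realType) (H : completeNormedModType R)
    (G : finGroupType) (act : G -> H -> H) : Prop := IsometricAction {
  isometric_action_linear : forall g, linear (act g);
  isometric_action_bij : forall g, bijective (act g);
  isometric_action_norm : forall g x, `|act g x| = `|x|;
  isometric_actionM : forall g' g x, act g' (act g x) = act (g' * g)%g x;
  isometric_action1 : forall x, act 1%g x = x
}.

Definition minimizes (R : realType) (T : Type) (f : T -> R) (x : T) : Prop :=
  forall y, f x <= f y.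

Definition local_minimum (R : realType) (H : completeNormedModType R)
    (f : H -> R) (x : H) : Prop :=
  \forall y \near x, f x <= f y.

Section MaxMax.
Variables (R : realType) (H : completeNormedModType R) (G : finGroupType).
Variables (act : G -> H -> H) (N : nat) (Y : 'I_N -> H).

Definition act_orbit (x : H) : set H := [set act g x | g in [set: G]].

Definition registration (x : H) (i : 'I_N) (g : G) : Prop :=
  minimizes (fun h => `|x - act h (Y i)|) g.

Definition J (x : H) (g : {ffun 'I_N -> G}) : R :=
  N%:R^-1 * \sum_(i < N) `|x - act (g i) (Y i)| ^+ 2.

(* The initial value of the iterated minimum is the term at g = 1, so that
   this is exactly the minimum over G. *)
Definition empirical_variance (x : H) : R :=
  N%:R^-1 * \sum_(i < N)
    \big[Num.min/`|x - act 1%g (Y i)| ^+ 2]_(g : G) `|x - act g (Y i)| ^+ 2.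

(* An orbit is an empirical Karcher mean when it is the orbit of a local
   minimum of the empirical variance. *)
Definition empirical_Karcher_mean (O : set H) : Prop :=
  exists2 x, local_minimum empirical_variance x & O = act_orbit x.

(* [m 0, ..., m n.+1] and [g 0, ..., g n] are the iterates of a run stopping
   at step [n]; later values of [m] and [g] are irrelevant. Registrations need
   not be unique, so the result is a relation and not a function of [m0]. *)
Definition maxmax_result (m0 mhat : H) : Prop :=
  exists (m : nat -> H) (g : nat -> {ffun 'I_N -> G}) (n : nat),
    [/\ m 0%N = m0,
        forall k, (k <= n)%N ->
          minimizes (J (m k)) (g k) /\ minimizes (J ^~ (g k)) (m k.+1),
        forall k, (k < n)%N -> m k.+1 <> m k,
        m n.+1 = m n
      & mhat = m n].

End MaxMax.

(* Main.v *)
Require Import Defs.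
From mathcomp Require Import all_boot all_order all_algebra all_fingroup.
From mathcomp Require Import all_classical all_reals all_analysis.

Import Order.TTheory GRing.Theory Num.Theory.
Import numFieldNormedType.Exports.
Local Open Scope classical_set_scope.
Local Open Scope ring_scope.

Set Implicit Arguments.
Unset Strict Implicit.

(** The empirical variance [F] is the lower envelope of the finitely many
functions [J ^~ g], one for each choice [g] of group elements
([empirical_variance_le_J]). A result [mhat] of the algorithm comes with a
choice [g] such that [mhat] minimizes [J ^~ g] and each [g i] registers the
[i]-th sample point with respect to [mhat] ([maxmax_result_fixpoint]).

When registrations at [mhat] are unique, [g i] beats every other group element
strictly.  Only finitely many strict inequalities between continuous functions
of the base point are involved, so the same [g] still registers the sample with
respect to every [x] near [mhat] ([registration_near]); for such [x] the
envelope is attained at [g] ([empirical_variance_registration]), and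
[F x = J x g >= J mhat g >= F mhat]. *)

Lemma closer_point_near (R : realType) (H : normedModType R)
    (x a b : H) :
  `|x - a| < `|x - b| -> \forall y \near x, `|y - a| < `|y - b|.
Proof.
move=> xab.
have dist_diff_cvg : `|y - b| - `|y - a| @[y --> x] --> `|x - b| - `|x - a|.
  by apply: cvgB; apply: cvg_norm; apply: cvgB; [exact: cvg_id|exact: cvg_cst
    |exact: cvg_id|exact: cvg_cst].
near=> y.
rewrite -subr_gt0.
near: y.
by apply: (cvgr_gt _ dist_diff_cvg); rewrite subr_gt0.
Unshelve. all: by end_near. Qed.

Section MaxMaxTheory.
Variables (R : realType) (H : completeNormedModType R) (G : finGroupType).
Variables (act : G -> H -> H) (N : nat) (Y : 'I_N -> H).
Implicit Types (x : H) (g : {ffun 'I_N -> G}).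

Lemma empirical_variance_le_J x g :
  empirical_variance act Y x <= J act Y x g.
Proof.
rewrite ler_wpM2l ?invr_ge0 ?ler0n//.
by apply: ler_sum => i _; exact: bigmin_le_cond.
Qed.

Lemma empirical_variance_registration x g :
  (forall i, registration act Y x i (g i)) ->
  empirical_variance act Y x = J act Y x g.
Proof.
move=> reg; apply/eqP; rewrite eq_le empirical_variance_le_J/=.
rewrite ler_wpM2l ?invr_ge0 ?ler0n//; apply: ler_sum => i _.
have le_reg h : `|x - act (g i) (Y i)| ^+ 2 <= `|x - act h (Y i)| ^+ 2.
  by rewrite lerXn2r ?nnegrE//; exact: reg.
by apply: le_bigmin => [|h _]; exact: le_reg.
Qed.

(** The terms of [J x g] depend on separate coordinates of [g], so changing a
single coordinate of a minimizer compares a single term. *)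
Lemma minimizes_J_registration x g i :
  minimizes (J act Y x) g -> registration act Y x i (g i).
Proof.
move=> gmin h.
have N_gt0 : (0 < N)%N by exact: leq_ltn_trans (ltn_ord i).
have := gmin [ffun j => if j == i then h else g j].
rewrite ler_pM2l ?invr_gt0 ?ltr0n// (bigD1 i)//= [leRHS](bigD1 i)//= ffunE eqxx.
under [in leRHS]eq_bigr => j /negPf ji do rewrite ffunE ji.
by rewrite lerD2r ler_pXn2r ?nnegrE.
Qed.

(** At the last step [m n.+1 = m n], so the registration and the averaging of
that step concern the same point. *)
Lemma maxmax_result_fixpoint (m0 mhat : H) :
  maxmax_result act Y m0 mhat ->
  exists g, (forall i, registration act Y mhat i (g i)) /\
            minimizes (J act Y ^~ g) mhat.
Proof.
move=> [m [g [n [_ step _ stop ->]]]].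
have [gmin mmin] := step n (leqnn n).
exists (g n); split; last by rewrite -stop.
by move=> i; exact: minimizes_J_registration.
Qed.

Lemma unique_registration_lt x i (r h : G) :
  (exists! k, registration act Y x i k) -> registration act Y x i r ->
  h != r -> `|x - act r (Y i)| < `|x - act h (Y i)|.
Proof.
move=> [k [_ kuniq]] rreg; rewrite ltNge; apply: contraNN => hr.
have hreg : registration act Y x i h.
  by move=> l; exact: le_trans hr (rreg l).
by rewrite -(kuniq _ hreg) (kuniq _ rreg).
Qed.

Lemma registration_near x g :
  (forall i, exists! k, registration act Y x i k) ->
  (forall i, registration act Y x i (g i)) ->
  \forall y \near x, forall i, registration act Y y i (g i).
Proof.
move=> regU reg; apply: filter_forall => i; apply: filter_forall => h.
have [->|hg] := eqVneq h (g i); first by apply: nearW => y; exact: lexx.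
have := closer_point_near (unique_registration_lt (regU i) (reg i) hg).
by apply: filterS => y; exact: ltW.
Qed.

End MaxMaxTheory.

Unset Implicit Arguments.
Set Strict Implicit.

Theorem proposition2 (R : realType) (H : completeNormedModType R)
    (dot : {dot H for idfun}) (hdot : hilbert_norm dot)
    (G : finGroupType) (act : G -> H -> H) (hact : isometric_action act)
    (N : nat) (hN : (1 <= N)%N) (Y : 'I_N -> H)
    (m0 mhat : H) (hmhat : maxmax_result act Y m0 mhat)
    (hreg : forall i : 'I_N, exists! g : G, registration act Y mhat i g) :
  local_minimum (empirical_variance act Y) mhat /\
  empirical_Karcher_mean act Y (act_orbit act mhat).
Proof.
have mhat_min : local_minimum (empirical_variance act Y) mhat.
  have [g [greg gmin]] := maxmax_result_fixpoint hmhat.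
  apply: filterS (registration_near hreg greg) => x xreg.
  rewrite (empirical_variance_registration xreg).
  exact: le_trans (empirical_variance_le_J act Y mhat g) (gmin x).
by split=> //; exists mhat.
Qed.
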